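(* Let $(B,+,\circ)$ be a skew brace. If either $(B,+)$ or $(B,\circ)$ is a divisible periodic abelian group of finite abelian subgroup rank, then $B$ is trivial.
   Context: A skew brace is a triple $(B,+,\circ)$ with $(B,+)$, $(B,\circ)$ (not necessarily abelian) groups such that $a\circ(b+c)=a\circ b-a+a\circ c$ for all $a,b,c\in B$. $B$ is trivial if $a+b=a\circ b$ for all $a,b\in B$. An abelian group is divisible if it is $p$-divisible for every prime $p$ (multiplication by $p$ is surjective), and periodic if all its elements have finite order. The $0$-rank of an abelian group $A$ is the cardinality of a maximal independent set of elements of infinite order; for a prime $p$, the $p$-rank of $A$ is the cardinality of a maximal independent set of non-trivial elements of $p$-power order. $A$ has finite abelian subgroup rank if its $0$-rank and its $p$-rank for every prime $p$ are finite. *)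

(* Defs.v *)
From HB Require Import structures.
From mathcomp Require Import all_boot ssralg ssrint.
From mathcomp Require Import classical_sets cardinality.

Set Implicit Arguments.
Unset Strict Implicit.
Unset Printing Implicit Defensive.

Local Open Scope group_scope.
Local Open Scope classical_set_scope.

Declare Scope brace_scope.
Delimit Scope brace_scope with brace.

(* The neutral elements of the two groups are separate fields; that they are
   equal is a consequence of the axioms. *)
HB.mixin Record isSkewBrace B of Choice B := {
  brace_zero : B;
  brace_opp : B -> B;
  brace_add : B -> B -> B;
  brace_addA : associative brace_add;
  brace_add0l : left_id brace_zero brace_add;
  brace_add0r : right_id brace_zero brace_add;
  brace_addNl : left_inverse brace_zero brace_opp brace_add;
  brace_addNr : right_inverse brace_zero brace_opp brace_add;
  brace_one : B;
  brace_inv : B -> B;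
  brace_circ : B -> B -> B;
  brace_circA : associative brace_circ;
  brace_circ1l : left_id brace_one brace_circ;
  brace_circ1r : right_id brace_one brace_circ;
  brace_circVl : left_inverse brace_one brace_inv brace_circ;
  brace_circVr : right_inverse brace_one brace_inv brace_circ;
  brace_circD : forall a b c,
    brace_circ a (brace_add b c) =
    brace_add (brace_add (brace_circ a b) (brace_opp a)) (brace_circ a c)
}.

#[short(type="skewBraceType")]
HB.structure Definition SkewBrace := {B of isSkewBrace B & Choice B}.

Notation "a + b" := (brace_add a b) : brace_scope.
Notation "a ∘ b" := (brace_circ a b)
  (at level 40, left associativity) : brace_scope.

(* (B, +) and (B, ∘) as objects of the library's (multiplicatively written)
   groupType: aliases of the carrier, each carrying one of the two laws. *)
Definition add_group (B : Type) : Type := B.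
Definition circ_group (B : Type) : Type := B.

Section Groups.
Variable B : skewBraceType.

HB.instance Definition _ := Choice.copy (add_group B) B.
HB.instance Definition _ := isGroup.Build (add_group B)
  (@brace_addA B) (@brace_add0l B) (@brace_add0r B) (@brace_addNl B) (@brace_addNr B).

HB.instance Definition _ := Choice.copy (circ_group B) B.
HB.instance Definition _ := isGroup.Build (circ_group B)
  (@brace_circA B) (@brace_circ1l B) (@brace_circ1r B) (@brace_circVl B) (@brace_circVr B).

Definition trivial_brace : Prop := forall a b : B, (a + b = a ∘ b)%brace.

End Groups.

Section GroupNotions.
Variable G : groupType.
Implicit Types (x y : G) (P S T : set G).

Definition abelian_group : Prop := forall x y, commute x y.

Definition p_divisible (p : nat) : Prop := forall x, exists y, y ^+ p = x.

Definition divisible : Prop := forall p, prime p -> p_divisible p.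

Definition finite_order x : Prop := exists2 n, (0 < n)%N & x ^+ n = 1.

Definition periodic : Prop := forall x, finite_order x.

Definition expgz x (k : int) : G :=
  match k with Posz n => x ^+ n | Negz n => x ^- n.+1 end.

(* Independence in the sense of abelian group theory: a relation
   k_1 x_1 + ... + k_r x_r = 0 between distinct elements of S forces every
   k_i x_i (not necessarily k_i) to be zero.  Only used for abelian G, where the
   order of the factors is immaterial. *)
Definition independent S : Prop :=
  forall (s : seq G) (k : G -> int), uniq s -> (forall x, x \in s -> S x) ->
    \prod_(x <- s) expgz x (k x) = 1 -> forall x, x \in s -> expgz x (k x) = 1.

Definition max_independent P S : Prop :=
  [/\ S `<=` P, independent S &
      forall T, S `<=` T -> T `<=` P -> independent T -> T = S].

(* For abelian G, all maximal independent sets of elements of infinite order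
   (resp. of nontrivial elements of p-power order) have the same cardinality. *)
Definition finite_rank P : Prop :=
  exists2 S, max_independent P S & finite_set S.

Definition infinite_order : set G := [set x | ~ finite_order x].

Definition p_power_order (p : nat) : set G :=
  [set x | x <> 1 /\ exists k : nat, x ^+ (p ^ k)%N = 1].

Definition finite_abelian_subgroup_rank : Prop :=
  finite_rank infinite_order /\
  (forall p : nat, prime p -> finite_rank (p_power_order p)).

End GroupNotions.

(* Main.v *)
From HB Require Import structures.
Require Import Defs.
From mathcomp Require Import all_boot ssralg ssrint.
From mathcomp Require Import boolp classical_sets cardinality.

(** Write [lambda a b = - a + a ∘ b], so that [a ∘ b = a + lambda a b]: the
    claim is that the action [lambda] of (B,∘) on (B,+) is trivial.  Both halves
    rest on the same remark: a divisible group has no proper subgroup of finite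
    index, hence no nontrivial action on a finite set.  In both cases the rank
    hypothesis is used through one consequence: there are only finitely many
    elements of each order ([finite_rank_torsion]).

    If (B,+) is the divisible group, each [lambda a] preserves the finite
    subgroups B[n], so it has finite order.  An automorphism of finite order of
    a p-divisible abelian group that is trivial on the finite group B[p^2] is
    trivial on all elements of p-power order ([finite_order_rigid]).  So the
    kernel of the action on the p-part B_p has finite index in (B,∘), although
    nothing is known yet about divisibility of (B,∘).  Inside B_p this kernel K
    satisfies k ∘ b = k + b, hence it also has finite index in the divisible
    group (B_p,+), and K = B_p.  Thus every B_q is a trivial brace, so that ∘ and
    + agree there, and the same count shows that B_q acts trivially on B_p for
    all primes p and q ([primary_acts_trivially]).

    If (B,∘) is the divisible group, form the semidirect product G of (B,+) by
    (B,∘).  The pairs (b,b) and the pairs (0,c) form two copies of (B,∘) in G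
    whose product is G and which meet trivially.  It must be shown that
    they commute ([factors_commute]).  By Itô's argument ([ito]) the commutators
    between the two factors commute with each other; let V be the center of
    their centralizer, an abelian normal subgroup that contains them, with G/V
    abelian.  Writing v in V as k^-1 l with k and l in the two factors, the
    operation (v,w) |-> [w,k] makes V a commutative radical ring, whose adjoint
    operation multiplies k and l and is therefore periodic.  In such a
    ring, an ideal N with the property that p x in N and x^2 in N imply x in N
    for every prime p is the whole ring ([radical_ring_ideal_full]).  This is
    applied to the central elements N of V: the x with p x and x^2 in N
    form, modulo the center of G, a finite set invariant under conjugation, so
    the divisible factors centralize it modulo the center
    ([finite_orbit_central]), and then, commutators with torsion elements being
    torsion, absolutely ([torsion_central_comm]).  Hence V is central, and one
    more application of the last principle shows that the factors commute. *)

Set Implicit Arguments.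
Unset Strict Implicit.
Unset Printing Implicit Defensive.

(** * Commutative radical rings with periodic adjoint group *)

Section RadicalRing.
Import GRing.Theory.
Local Open Scope ring_scope.
Variables (V : zmodType) (mul : V -> V -> V).
Local Notation "x ** y" := (mul x y) (at level 40, left associativity).
Hypothesis mulC : forall x y, x ** y = y ** x.
Hypothesis mulA : forall x y z, x ** (y ** z) = x ** y ** z.
Hypothesis mulDr : forall x y z, x ** (y + z) = x ** y + x ** z.

Lemma rmulDl x y z : (x + y) ** z = x ** z + y ** z.
Proof. by rewrite mulC mulDr !(mulC z). Qed.

Lemma rmulr0 x : x ** 0 = 0.
Proof. by apply: (@addrI _ (x ** 0)); rewrite -mulDr !addr0. Qed.

Lemma rmulrMn x y n : x ** (y *+ n) = (x ** y) *+ n.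
Proof.
by elim: n => [|n IHn]; rewrite ?mulr0n ?rmulr0 // !mulrS mulDr IHn.
Qed.

Lemma rmulMnl x y n : (x *+ n) ** y = (x ** y) *+ n.
Proof. by rewrite mulC rmulrMn mulC. Qed.

(** The adjoint operation: 1 + [circ x y] = (1 + x)(1 + y) in the ring
    obtained by adjoining a unit. *)
Definition circ x y := x + y + x ** y.
Definition circn x n := iter n (circ x) 0.

Lemma circA x y z : circ x (circ y z) = circ (circ x y) z.
Proof.
rewrite /circ !mulDr !rmulDl mulA !addrA.
by rewrite [LHS](ACl (1*2*5*3*6*4*7)).
Qed.

Lemma circ0 x : circ 0 x = x.
Proof. by rewrite /circ mulC rmulr0 add0r addr0. Qed.

Lemma circnS x n : circn x n.+1 = circ x (circn x n). Proof. by []. Qed.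

Lemma circn1 x : circn x 1 = x.
Proof. by rewrite circnS /circn /= /circ rmulr0 !addr0. Qed.

Lemma circnD x m n : circn x (m + n) = circ (circn x m) (circn x n).
Proof. by elim: m => [|m IHm]; rewrite ?circ0 // addSn !circnS IHm circA. Qed.

Lemma circnM x m n : circn x (n * m) = circn (circn x m) n.
Proof. by elim: n => [|n IHn]; rewrite ?mul0n // mulSn circnD IHn -circnS. Qed.

(** Without a unit, divisibility of (1 + x)^n - 1 by x reads: it is the sum of
    an integer multiple and a ring multiple of x. When the left side vanishes,
    n x lies in the ideal that x generates. *)
Lemma circn_linear x n : exists w, circn x n = x *+ n + w ** x.
Proof.
elim: n => [|n [w IHn]].
  by exists 0; rewrite mulC rmulr0 mulr0n addr0.
exists (w + circn x n); rewrite circnS /circ rmulDl mulrS [x ** _]mulC.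
by rewrite {1}IHn !addrA.
Qed.

Lemma circn_multiple y n k : exists z, circn (y *+ k) n = z *+ k.
Proof.
elim: n => [|n [z IHn]]; first by exists 0; rewrite mul0rn.
exists (y + z + (y *+ k) ** z).
by rewrite circnS IHn /circ !mulrnDl rmulrMn.
Qed.

(** If x is k times an element, the terms of (1 + x)^n - 1 beyond n x add up
    to k times a ring multiple of x; this sharpens [circn_linear] enough to
    divide by k. *)
Lemma circn_linear_multiple y n k :
  exists w, circn (y *+ k) n = (y *+ k) *+ n + (w *+ k) ** (y *+ k).
Proof.
elim: n => [|n [w IHn]].
  by exists 0; rewrite mul0rn mulC rmulr0 mulr0n addr0.
have [z zE] := circn_multiple y n k.
exists (w + z); rewrite circnS /circ mulrnDl rmulDl mulrS.
by rewrite {1}IHn zE [_ ** (z *+ k)]mulC !addrA.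
Qed.

(** The power x^(i+1): without a unit there is no exponent 0. *)
Definition rpow x i := iter i (mul x) x.

Lemma rpowS x i : rpow x i.+1 = x ** rpow x i. Proof. by []. Qed.

Lemma rpowD x i j : rpow x i ** rpow x j = rpow x (i + j).+1.
Proof. by elim: i => [|i IHi] //; rewrite addSn !rpowS -mulA IHi. Qed.

Lemma circn_binomial x n : circn x n = \sum_(i < n) rpow x i *+ 'C(n, i.+1).
Proof.
elim: n => [|n IHn]; first by rewrite big_ord0.
rewrite circnS /circ IHn.
have mul_sum (F : 'I_n -> V) : x ** (\sum_i F i) = \sum_i x ** F i.
  apply: (big_morph (mul x)); [exact: mulDr | exact: rmulr0].
rewrite mul_sum.
have -> : \sum_(i < n.+1) rpow x i *+ 'C(n.+1, i.+1) =
  \sum_(i < n.+1) rpow x i *+ 'C(n, i.+1) + \sum_(i < n.+1) rpow x i *+ 'C(n, i).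
  by rewrite -big_split; apply: eq_bigr => i _; rewrite binS mulrnDr.
rewrite big_ord_recr /= bin_small // mulr0n addr0.
rewrite [in RHS]big_ord_recl /= bin0 mulr1n.
have -> : \sum_(i < n) x ** (rpow x i *+ 'C(n, i.+1)) =
  \sum_(i < n) rpow x i.+1 *+ 'C(n, i.+1).
  by apply: eq_bigr => i _; rewrite rmulrMn.
by rewrite [LHS](AC (2*1) (2*(1*3))).
Qed.

Variable N : set V.
Hypothesis N0 : N 0.
Hypothesis ND : forall x y, N x -> N y -> N (x + y).
Hypothesis NN : forall x, N x -> N (- x).
Hypothesis NM : forall v x, N x -> N (v ** x).
Hypothesis N_radical : forall v y, N (y + v ** y) -> N y.

Lemma idealMn x n : N x -> N (x *+ n).
Proof. by move=> Nx; elim: n => [|n IHn]; rewrite ?mulr0n // mulrS; apply: ND. Qed.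

Lemma idealDl x y : N x -> N (x + y) -> N y.
Proof. by move=> Nx Nxy; rewrite -(addKr x y); apply: ND => //; apply: NN. Qed.

Lemma ideal_sum n (F : 'I_n -> V) : (forall i, N (F i)) -> N (\sum_i F i).
Proof. by move=> NF; elim/big_ind: _. Qed.

(** By Bezout the two relations express y modulo N as a ring multiple of y,
    and radicality then annihilates y. The hypothesis [N_radical] stands for
    the invertibility of 1 + v modulo N. *)
Lemma coprime_linear_ideal a b u v y : (0 < a)%N -> coprime a b ->
  N (y *+ a + u ** y) -> N (y *+ b + v ** y) -> N y.
Proof.
move=> a_gt0 co_ab Na Nb.
have [k l klE _] := egcdnP b a_gt0; rewrite (eqP co_ab) in klE.
apply: (@N_radical (u *+ k - v *+ l)).
have -> : y + (u *+ k - v *+ l) ** y =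
  (y *+ a + u ** y) *+ k - (y *+ b + v ** y) *+ l.
  have mulN z : (- z) ** y = - (z ** y).
    apply: (@addrI _ (z ** y)); rewrite -rmulDl !subrr.
    by rewrite mulC rmulr0.
  rewrite !mulrnDl rmulDl mulN !rmulMnl -!mulrnA (mulnC a) (mulnC b) klE.
  rewrite mulrnDr mulr1n opprD !addrA.
  by rewrite [RHS](ACl (1*4*2*3*5)) /= subrr add0r.
by apply: ND; [|apply: NN]; apply: idealMn.
Qed.

Lemma square_zero_circn x n : N (x ** x) -> N (x *+ n) -> N (circn x n).
Proof.
move=> Nxx Nxn; rewrite circn_binomial.
case: n Nxn => [|n] Nxn; first by rewrite big_ord0.
rewrite big_ord_recl /= bin1; apply: ND => //.
apply: ideal_sum => i; apply: idealMn => /=.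
by elim: (nat_of_ord i) => //= j IHj; apply: NM.
Qed.

Hypothesis no_square_zero : forall p x, prime p -> N (x *+ p) -> N (x ** x) -> N x.

(** The last power outside N would be an element of square zero. *)
Lemma nilpotent_ideal p x i : prime p -> N (x *+ p) -> N (rpow x i) -> N x.
Proof.
move=> p_pr Nxp; elim: i => // i IHi Ni; apply: IHi.
apply: (no_square_zero p_pr).
  case: i {Ni} => [//|i]; rewrite rpowS mulC -rmulrMn.
  exact: NM.
case: i Ni => [//|i] Ni.
by rewrite rpowD [in X in rpow x X]addnS -addSn addnC -rpowD; apply: NM.
Qed.

(** Modulo p the binomial formula reduces to (1 + y)^p = 1 + y^p. *)
Lemma prime_circn_pow p y : prime p -> N (y *+ p) -> N (circn y p) ->
  N (rpow y p.-1).
Proof.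
case: p => // p p_pr Nyp; rewrite circn_binomial big_ord_recr /= binn mulr1n.
apply: idealDl; apply: ideal_sum => i.
have /dvdnP[k ->] : (p.+1 %| 'C(p.+1, i.+1))%N.
  by rewrite prime_dvd_bin //= ltnS.
rewrite mulnC mulrnA; apply: idealMn.
case: i => [[|i] ?] //=; rewrite mulC -rmulrMn; exact: NM.
Qed.

(** If p does not divide the adjoint order m of x, the relations p x = 0 and m
    x = - w x are coprime. Otherwise an adjoint power of x has adjoint order
    p, so it is nilpotent, and m decreases. *)
Lemma torsion_ideal p x m : prime p -> (0 < m)%N -> N (x *+ p) -> N (circn x m) -> N x.
Proof.
move=> p_pr; elim/ltn_ind: m => m IHm in x * => m_gt0 Nxp Nxm.
have [p_m | co_pm] := boolP (p %| m)%N; last first.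
  have [w wE] := circn_linear x m; rewrite wE in Nxm.
  apply: (@coprime_linear_ideal p m 0 w) => //; first exact: prime_gt0.
    by rewrite prime_coprime.
  by rewrite mulC rmulr0 addr0.
have mE : m = (p * (m %/ p))%N by rewrite mulnC divnK.
have q_gt0 : (0 < m %/ p)%N by rewrite divn_gt0 ?prime_gt0 // dvdn_leq.
apply: (IHm (m %/ p)) => //; first by rewrite ltn_Pdiv ?prime_gt1.
rewrite mE circnM in Nxm; set y := circn x (m %/ p) in Nxm *.
have Nyp : N (y *+ p).
  have [w] := circn_linear x (m %/ p); rewrite -/y => ->.
  rewrite mulrnDl -rmulrMn -mulrnA mulnC mulrnA.
  by apply: ND; [apply: idealMn | apply: NM].
exact: nilpotent_ideal p_pr Nyp (prime_circn_pow p_pr Nyp Nxm).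
Qed.

Hypothesis circ_torsion : forall x, exists2 m, (0 < m)%N & N (circn x m).

Lemma ideal_divides p x : prime p -> N (x *+ p) -> N x.
Proof.
by move=> p_pr Nxp; have [m m_gt0] := circ_torsion x; apply: torsion_ideal Nxp.
Qed.

(** Besides y itself, its multiple l y has finite adjoint order. Modulo N no
    nonzero multiple of l has adjoint order l (divide the relation of
    [circn_linear_multiple] by l), so the order of l y is prime to l; the
    linear relations for y and l y then have coprime coefficients. *)
Lemma prime_circ_order l y : prime l -> N (circn y l) -> N y.
Proof.
move=> l_pr Nyl.
have no_l_torsion z : N (circn (z *+ l) l) -> N (z *+ l).
  have [w ->] := circn_linear_multiple z l l.
  rewrite rmulMnl -mulrnDl => /(ideal_divides l_pr).
  exact: N_radical.
have [m m_gt0 Nxm] := circ_torsion (y *+ l).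
have [n n_gt0 [co_ln Nxn]] :
    exists2 n, (0 < n)%N & coprime l n /\ N (circn (y *+ l) n).
  elim/ltn_ind: m => m IHm in m_gt0 Nxm *.
  have [l_m | ?] := boolP (l %| m)%N; last by exists m; rewrite ?prime_coprime.
  have q_gt0 : (0 < m %/ l)%N by rewrite divn_gt0 ?prime_gt0 // dvdn_leq.
  apply: (IHm (m %/ l)) => //; first by rewrite ltn_Pdiv ?prime_gt1.
  have [z zE] := circn_multiple y (m %/ l) l.
  by rewrite zE; apply: no_l_torsion; rewrite -zE -circnM mulnC divnK.
have [w wE] := circn_linear y l; rewrite wE in Nyl.
have [v vE] := circn_linear (y *+ l) n; rewrite vE in Nxn.
apply: (@coprime_linear_ideal l n w v) => //; first exact: prime_gt0.
apply: (ideal_divides l_pr).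
by rewrite mulrnDl -rmulrMn -mulrnA mulnC mulrnA.
Qed.

(** In a commutative radical ring with periodic adjoint operation, nilpotent
    elements killed by a prime are the only obstruction to being zero; the
    statement is relative to an ideal N in order to avoid the quotient
    ring. *)
Theorem radical_ring_ideal_full x : N x.
Proof.
have [m] := circ_torsion x; elim/ltn_ind: m => m IHm m_gt0 Nxm.
have [m1 | m_neq1] := eqVneq m 1%N; first by rewrite -(circn1 x) -m1.
have l_pr : prime (pdiv m) by rewrite pdiv_prime // ltn_neqAle eq_sym m_neq1.
have l_m := pdiv_dvd m; set l := pdiv m in l_pr l_m.
have q_gt0 : (0 < m %/ l)%N by rewrite divn_gt0 ?prime_gt0 // dvdn_leq.
apply: (IHm (m %/ l)) => //; first by rewrite ltn_Pdiv ?prime_gt1.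
by apply: (prime_circ_order l_pr); rewrite -circnM mulnC divnK.
Qed.

End RadicalRing.

Local Open Scope group_scope.
Local Open Scope classical_set_scope.

(** * Pigeonhole principles *)

Section Pigeonhole.

Lemma pigeonhole_finType (T : finType) (f : nat -> T) :
  exists i j, (i < j <= #|T|)%N /\ f i = f j.
Proof.
pose g (i : 'I_#|T|.+1) := f i.
have /injectivePn[i [j]] : ~~ injectiveb g.
  apply/injectiveP => /leq_card; rewrite card_ord ltnn //.
wlog lt_ij : i j / (i < j)%N => [th|].
  have [/th|/th|/val_inj->] := ltngtP i j; last by rewrite eqxx.
    exact.
  by rewrite eq_sym => th' ? ?; apply: th'.
by move=> _ gij; exists i, j; rewrite lt_ij -ltnS ltn_ord.
Qed.

(** The bound depends only on the finite set, not on the sequence of maps. *)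
Lemma pigeonhole_maps (T : eqType) (F : set T) : finite_set F ->
  exists M, forall h : nat -> T -> T, (forall i x, F x -> F (h i x)) ->
    exists i j, (i < j <= M)%N /\ forall x, F x -> h i x = h j x.
Proof.
move=> /finite_seqP[s ->].
exists #|{: {ffun 'I_(size s) -> 'I_(size s).+1}}| => h hF.
have [i [j [ij hij]]] := pigeonhole_finType (fun i =>
  [ffun k : 'I_(size s) =>
     inord (index (h i (tnth (in_tuple s) k)) s) : 'I_(size s).+1]).
exists i, j; split=> // x /= xs.
have lt_k : (index x s < size s)%N by rewrite index_mem.
move/ffunP/(_ (Ordinal lt_k)): hij; rewrite !ffunE.
rewrite (tnth_nth x) /= nth_index // => /(congr1 val).
rewrite /= !inordK ?ltnS ?index_size // => eq_index.
by rewrite -(nth_index x (hF i x xs)) eq_index nth_index //; apply: hF.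
Qed.

Lemma pigeonhole_set (T : eqType) (F : set T) : finite_set F ->
  exists M, forall f : nat -> T, (forall i, F (f i)) ->
    exists i j, (i < j <= M)%N /\ f i = f j.
Proof.
move=> /pigeonhole_maps[M pig]; exists M => f fF.
have [i [j [ij fij]]] := pig (fun i _ => f i) (fun i _ _ => fF i).
by exists i, j; split=> //; apply: (fij (f 0%N)).
Qed.

Lemma finite_eventually (T : eqType) (F : set T) (P : T -> nat -> Prop) :
  finite_set F -> (forall x m n, (m <= n)%N -> P x m -> P x n) ->
  (forall x, F x -> exists n, P x n) -> exists n, forall x, F x -> P x n.
Proof.
move=> /finite_seqP[s ->] mono; elim: s => [|y s IHs] Pex; first by exists 0%N.
have [|n nP] := IHs; first by move=> x xs; apply: Pex; rewrite /= inE xs orbT.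
have [|m mP] := Pex y; first by rewrite /= inE eqxx.
exists (maxn m n) => x /=; rewrite inE => /orP[/eqP->|xs].
  by apply: mono mP; rewrite leq_maxl.
by apply: mono (nP x xs); rewrite leq_maxr.
Qed.

End Pigeonhole.

(** * Homomorphisms and powers *)

Section Homomorphisms.
Variables (H G : groupType) (f : H -> G).
Hypothesis fM : forall x y, f (x * y) = f x * f y.

Lemma hom1 : f 1 = 1.
Proof. by apply: (mulgI (f 1)); rewrite -fM !mulg1. Qed.

Lemma homV x : f x^-1 = (f x)^-1.
Proof. by apply: (mulgI (f x)); rewrite -fM !mulgV hom1. Qed.

Lemma homX x n : f (x ^+ n) = f x ^+ n.
Proof. by elim: n => [|n IHn]; rewrite ?expg0 ?hom1 // !expgS fM IHn. Qed.

End Homomorphisms.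

Section Powers.
Variable A : groupType.
Implicit Types x y : A.

Lemma expg_dvd x m n : (m %| n)%N -> x ^+ m = 1 -> x ^+ n = 1.
Proof. by move=> /dvdnP[k ->] xm; rewrite mulnC expgnA xm expg1n. Qed.

Lemma expg_modn x m n : x ^+ m = 1 -> x ^+ (n %% m) = x ^+ n.
Proof.
by move=> xm; rewrite [in RHS](divn_eq n m) expgnDr mulnC expgnA xm expg1n mul1g.
Qed.

Lemma expg_coprime_eq1 x m n : (0 < m)%N -> coprime m n ->
  x ^+ m = 1 -> x ^+ n = 1 -> x = 1.
Proof.
move=> m_gt0 co_mn xm xn; have [k l klE _] := egcdnP n m_gt0.
have := expg_dvd (dvdn_mull k (dvdnn m)) xm.
by rewrite klE (eqP co_mn) expgnDr (expg_dvd (dvdn_mull l (dvdnn n)) xn) mul1g.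
Qed.

Lemma expg_coprimeK x m n : coprime m n -> (0 < n)%N -> x ^+ m = 1 ->
  exists j, (x ^+ n) ^+ j = x.
Proof.
move=> co_mn n_gt0 xm; have [k l klE _] := egcdnP m n_gt0.
exists k; rewrite -expgnA mulnC klE gcdnC (eqP co_mn) expgnDr expg1.
by rewrite (expg_dvd (dvdn_mull l (dvdnn m)) xm) mul1g.
Qed.

End Powers.

Lemma divisible_natexp (H : groupType) n (x : H) : divisible H -> (0 < n)%N ->
  exists y, y ^+ n = x.
Proof.
move=> divH; elim/ltn_ind: n x => n IHn x n_gt0.
have [->|n_neq1] := eqVneq n 1%N; first by exists x.
have p_pr : prime (pdiv n) by rewrite pdiv_prime // ltn_neqAle eq_sym n_neq1.
have p_n := pdiv_dvd n; set p := pdiv n in p_pr p_n.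
have q_gt0 : (0 < n %/ p)%N by rewrite divn_gt0 ?prime_gt0 // dvdn_leq.
have [|y yx] := IHn (n %/ p)%N _ x q_gt0; first by rewrite ltn_Pdiv ?prime_gt1.
have [z zy] := divH p p_pr y.
by exists z; rewrite -(divnK p_n) mulnC expgnA zy.
Qed.

(** * Periodic abelian groups of finite rank *)

Section AbelianTorsion.
Variable A : groupType.
Hypothesis abA : abelian_group A.
Implicit Types x y : A.

Lemma ab_expgM x y n : (x * y) ^+ n = x ^+ n * y ^+ n.
Proof. exact: expgMn. Qed.

Lemma ab_prod_rem (s : seq A) (f : A -> A) x : x \in s ->
  \prod_(y <- s) f y = f x * \prod_(y <- rem x s) f y.
Proof.
elim: s => //= y s IHs; rewrite inE big_cons eq_sym.
have [-> //|neq_yx /= /IHs ->] := eqVneq y x.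
by rewrite big_cons !mulgA (abA (f y)).
Qed.

Lemma torsion_expgz x n k : (0 < n)%N -> x ^+ n = 1 ->
  exists2 i, (i < n)%N & expgz x k = x ^+ i.
Proof.
move=> n_gt0 xn; case: k => k /=.
  by exists (k %% n)%N; rewrite ?ltn_mod ?expg_modn.
exists ((n.-1 * k.+1) %% n)%N; rewrite ?ltn_mod ?expg_modn //.
apply/esym/eqP; rewrite -mulg_eq1 -expgnDr addnC -mulSn prednK //.
by rewrite expgnA xn expg1n.
Qed.

(** A finitely generated periodic abelian group is finite. *)
Lemma finite_products (s : seq A) : (forall x, x \in s -> finite_order x) ->
  exists2 F : set A, finite_set F & forall (r : seq A) k,
    uniq r -> {subset r <= s} -> F (\prod_(x <- r) expgz x (k x)).
Proof.
elim: s => [|x s IHs] ords.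
  exists [set 1]; first exact: finite_set1.
  by case=> [|y r] k _ rs; [rewrite big_nil | have := rs y (mem_head _ _)].
have [|F finF FP] := IHs; first by move=> y ys; apply: ords; rewrite inE ys orbT.
have [|n n_gt0 xn] := ords x; first by rewrite inE eqxx.
exists [set y * z | y in (fun i => x ^+ i) @` `I_n & z in F].
  by apply: finite_image2 => //; apply: finite_image; apply: finite_II.
move=> r k uniq_r rs; have [x_r | x_r] := boolP (x \in r).
  rewrite (ab_prod_rem _ x_r); have [i lt_in ->] := torsion_expgz (k x) n_gt0 xn.
  exists (x ^+ i); first by exists i.
  exists (\prod_(y <- rem x r) expgz y (k y)) => //; apply: FP.
    exact: rem_uniq.
  move=> y; rewrite mem_rem_uniq // inE => /andP[/negPf y_x /rs].
  by rewrite inE y_x.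
exists 1; first by exists 0%N; rewrite ?expg0.
exists (\prod_(y <- r) expgz y (k y)); rewrite ?mul1g //; apply: FP => // y y_r.
by have := rs y y_r; rewrite inE => /predU1P[yx|//]; rewrite -yx y_r in x_r.
Qed.

(** Maximality of the independent set S makes S, together with an element x of
    order p outside S, dependent. The coefficient of x in the relation is
    prime to p, so x lies in the group generated by S, which is finite. *)
Lemma finite_rank_p_torsion p : prime p -> finite_rank (@p_power_order A p) ->
  finite_set [set x : A | x ^+ p = 1].
Proof.
move=> p_pr [S [SP indS maxS] finS]; have p_gt0 := prime_gt0 p_pr.
have [s sE] := (finite_seqP _).1 finS.
have [|F finF FP] := @finite_products s.
  move=> x xs; have /SP[_ [k xk]] : S x by rewrite sE.
  by exists (p ^ k)%N; rewrite ?expn_gt0 ?p_gt0.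
apply: (@sub_finite_set _ _
  ([set (y^-1) ^+ j | y in F & j in `I_p] `|` (S `|` [set 1]))); last first.
  rewrite !finite_setU; split; last by split=> //; exact: finite_set1.
  by apply: finite_image2 => //; apply: finite_II.
move=> x /= xp; have [x1|x_neq1] := pselect (x = 1); first by right; right.
have [Sx|nSx] := pselect (S x); first by right; left.
left; apply: contrapT => notF.
apply: nSx; rewrite -(maxS (x |` S)); first by left.
- by move=> y; right.
- by move=> y [->|/SP//]; split=> //; exists 1%N; rewrite expn1.
move=> r k uniq_r rS prod1; have [x_r | x_r] := boolP (x \in r); last first.
  apply: indS prod1 => // y y_r; have [yx|//] := rS y y_r.
  by rewrite -yx y_r in x_r.
rewrite (ab_prod_rem _ x_r) in prod1.
have rem_S y : y \in rem x r -> S y.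
  by rewrite mem_rem_uniq // inE => /andP[/eqP y_x /rS[]].
have Frem : F (\prod_(y <- rem x r) expgz y (k y)).
  apply: FP; first exact: rem_uniq.
  by move=> y /rem_S; rewrite sE.
have [i lt_ip xiE] := torsion_expgz (k x) p_gt0 xp.
have [i0|i_gt0] := posnP i; last first.
  case: notF; have [|j xj] := @expg_coprimeK A x p i _ i_gt0 xp.
    by rewrite prime_coprime // gtnNdvd.
  exists (\prod_(y <- rem x r) expgz y (k y)) => //; exists (j %% p)%N => /=.
    by rewrite ltn_mod.
  have -> : (\prod_(y <- rem x r) expgz y (k y))^-1 = x ^+ i.
    by apply/esym/eqP; rewrite -mulg_eq1 -xiE prod1.
  by rewrite expg_modn // -expgnA mulnC expgnA xp expg1n.
rewrite xiE i0 expg0 mul1g in prod1.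
move=> y y_r; have [->|y_x] := eqVneq y x; first by rewrite xiE i0 expg0.
apply: (indS (rem x r)) => //; first exact: rem_uniq.
by rewrite mem_rem_uniq // inE y_x.
Qed.

Definition finite_torsion : Prop :=
  forall n, (0 < n)%N -> finite_set [set x : A | x ^+ n = 1].

(** The fibers of x |-> x^p are cosets of the finite group of elements of
    order dividing p. *)
Lemma finite_rank_torsion :
  (forall p, prime p -> finite_rank (@p_power_order A p)) -> finite_torsion.
Proof.
move=> frank; elim/ltn_ind => n IHn n_gt0.
have [n1|n_neq1] := eqVneq n 1%N.
  apply: sub_finite_set (finite_set1 (1 : A)) => x /=.
  by rewrite n1 expg1.
have p_pr : prime (pdiv n) by rewrite pdiv_prime // ltn_neqAle eq_sym n_neq1.
have p_n := pdiv_dvd n; set p := pdiv n in p_pr p_n.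
have q_gt0 : (0 < n %/ p)%N by rewrite divn_gt0 ?prime_gt0 // dvdn_leq.
have fin_q : finite_set [set x : A | x ^+ (n %/ p) = 1].
  by apply: IHn; rewrite // ltn_Pdiv ?prime_gt1.
have fin_p := finite_rank_p_torsion p_pr (frank p p_pr).
(* r chooses a p-th root of each p-th power. *)
have [r rP] : exists r : A -> A, forall x, (r (x ^+ p)) ^+ p = x ^+ p.
  have [|r rP] := @choice A A (fun y z => forall x, x ^+ p = y -> z ^+ p = y).
    move=> y; have [[x xp]|nx] := pselect (exists x, x ^+ p = y).
      by exists x.
    by exists 1 => x xp; case: nx; exists x.
  by exists r => x; apply: rP.
apply: (@sub_finite_set _ _ [set r y * z | y in [set x : A | x ^+ (n %/ p) = 1] &
                        z in [set x : A | x ^+ p = 1]]); last first.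
  exact: finite_image2 fin_q fin_p.
move=> x /= xn; exists (x ^+ p) => /=.
  by rewrite -expgnA mulnC divnK.
exists ((r (x ^+ p))^-1 * x); last by rewrite mulVKg.
by rewrite /= ab_expgM expVgn rP mulVg.
Qed.

(** An element of a periodic group is a product of powers of itself that have
    prime power order. *)
Lemma primary_induction (Q : A -> Prop) : periodic A ->
  (forall x y, Q x -> Q y -> Q (x * y)) ->
  (forall p k x, prime p -> x ^+ (p ^ k) = 1 -> Q x) -> forall x, Q x.
Proof.
move=> perA QM Qp x; have [n] := perA x; elim/ltn_ind: n x => n IHn x n_gt0 xn.
have [n1|n_neq1] := eqVneq n 1%N; first by apply: (Qp 2 0%N); rewrite // expn0 -n1.
have p_pr : prime (pdiv n) by rewrite pdiv_prime // ltn_neqAle eq_sym n_neq1.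
have p_n := pdiv_dvd n; set p := pdiv n in p_pr p_n.
have p_gt0 := prime_gt0 p_pr.
have [m co_pm nE] := pfactor_coprime p_pr n_gt0; set s := logn p n in nE.
have s_gt0 : (0 < s)%N by rewrite logn_gt0 mem_primes p_pr n_gt0.
have m_gt0 : (0 < m)%N by move: n_gt0; rewrite nE muln_gt0 => /andP[].
have co_ps : coprime (p ^ s) m by rewrite coprimeXl.
(* Idempotents modulo n = m p^s: e + f = 1 modulo n. *)
pose e := chinese (p ^ s) m 1 0; pose f := chinese (p ^ s) m 0 1.
have -> : x = x ^+ e * x ^+ f.
  rewrite -expgnDr -[LHS]expg1 -(expg_modn 1 xn) -(expg_modn (e + f) xn).
  congr (x ^+ _); apply/eqP; rewrite nE mulnC chinese_remainder //.
  rewrite -!(modnDm e) chinese_modl // chinese_modr //.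
  rewrite (chinese_modl co_ps) (chinese_modr co_ps).
  by rewrite !modnDm !add0n !addn0 !eqxx.
have pse_e : (m %| e)%N by rewrite /dvdn chinese_modr // mod0n.
have pse_f : (p ^ s %| f)%N by rewrite /dvdn chinese_modl // mod0n.
apply: QM.
  apply: (Qp p s) => //; rewrite -expgnA; apply: expg_dvd xn.
  by rewrite nE dvdn_mul.
apply: (IHn m) => //.
  by rewrite [ltnRHS]nE ltn_Pmulr // -(expn0 p) ltn_exp2l ?prime_gt1.
rewrite -expgnA; apply: expg_dvd xn.
by rewrite nE mulnC dvdn_mul.
Qed.

(** The exponent m is the p'-part of the order of x, times its inverse modulo
    p. *)
Lemma p_part p x : periodic A -> prime p ->
  exists m b s, (x ^+ m) ^+ (p ^ s) = 1 /\ x ^+ m = x * (x ^+ p) ^+ b.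
Proof.
move=> perA p_pr; have [n n_gt0 xn] := perA x.
have [m co_pm nE] := pfactor_coprime p_pr n_gt0; set s := logn p n in nE.
have m_gt0 : (0 < m)%N by move: n_gt0; rewrite nE muln_gt0 => /andP[].
have [k l klE _] := egcdnP p m_gt0.
exists (k * m)%N, l, s; split.
  by rewrite -expgnA -mulnA -nE; apply: expg_dvd xn; rewrite dvdn_mull.
rewrite klE gcdnC (eqP co_pm) addnC expgnDr expg1 mulnC expgnA //.
Qed.

(** Finiteness of the p-torsion passes to the quotient by a subgroup E. The
    point is that E/E^p is finite: the subgroups T_k of p-th roots of unity
    that are p^k-th powers of elements of E decrease inside a finite set, so
    they are constant from some K0 on. From that index on, the order of an
    element of E can be lowered by dividing it by a p-th power of an element
    of E. Hence an element whose p-th power is in E is congruent modulo E to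
    one of order dividing p^(K0 + 1). *)
Lemma finite_roots_mod (E : set A) p : periodic A -> finite_torsion -> prime p ->
  E 1 -> (forall x y, E x -> E y -> E (x * y)) -> (forall x, E x -> E x^-1) ->
  exists2 F : set A, finite_set F &
    forall c, E (c ^+ p) -> exists2 f, F f & E (f^-1 * c).
Proof.
move=> perA finA p_pr E1 EM EV; have p_gt0 := prime_gt0 p_pr.
have EX x n : E x -> E (x ^+ n).
  by move=> Ex; elim: n => [|n IHn]; rewrite ?expg0 // expgS; apply: EM.
pose T k t := exists2 e, E e & e ^+ (p ^ k) = t.
have T_mono k l t : (k <= l)%N -> T l t -> T k t.
  move=> le_kl [e Ee <-]; exists (e ^+ (p ^ (l - k))); first exact: EX.
  by rewrite -expgnA -expnD subnK.
have [K0 K0P] : exists K0, forall t, t ^+ p = 1 -> T K0 t -> forall k, T k t.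
  apply: (@finite_eventually _ [set t : A | t ^+ p = 1]
    (fun t n => T n t -> forall k, T k t)).
  - exact: finA p_gt0.
  - by move=> t m n le_mn Tm Tn; apply: Tm; apply: T_mono Tn.
  move=> t _; have [Tt|/existsNP[k nTk]] := pselect (forall k, T k t).
    by exists 0%N.
  by exists k.
have E_mod s e : E e -> e ^+ (p ^ s) = 1 ->
    exists2 f, E f & (e * (f ^+ p)^-1) ^+ (p ^ K0) = 1.
  elim: s e => [|s IHs] e Ee es.
    exists 1 => //; rewrite expg1n invg1 mulg1.
    by move: es; rewrite expg1 => ->; rewrite expg1n.
  have [le_sK|lt_Ks] := leqP s.+1 K0.
    exists 1 => //; rewrite expg1n invg1 mulg1; apply: expg_dvd es.
    exact: dvdn_exp2l.
  have [||g Eg gE] := K0P (e ^+ (p ^ s)) _ _ s.+1.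
  - by rewrite -expgnA -expnSr.
  - by apply: (@T_mono _ s); [rewrite -ltnS | exists e].
  have [||f Ef fE] := IHs (e * (g ^+ p)^-1).
  - by apply: EM => //; apply: EV; apply: EX.
  - by rewrite ab_expgM expVgn -expgnA -expnS gE mulgV.
  exists (g * f); first exact: EM.
  by rewrite (ab_expgM g) invgM [X in e * X]abA mulgA.
exists [set x : A | x ^+ (p ^ K0.+1) = 1].
  by apply: finA; rewrite expn_gt0 p_gt0.
move=> c Ecp; have [m [b [s [cms cmE]]]] := p_part c perA p_pr.
have [||f Ef fE] := E_mod s ((c ^+ m) ^+ p).
- by rewrite cmE ab_expgM; apply: EM => //; exact/EX/EX.
- by rewrite -expgnA mulnC expgnA cms expg1n.
exists (c ^+ m * f^-1).
  by rewrite /= expnS expgnA ab_expgM expVgn.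
rewrite invgM invgK -mulgA; apply: EM => //.
by rewrite cmE invgM -mulgA mulVg mulg1; apply: EV; apply: EX.
Qed.

End AbelianTorsion.

(** * Divisible periodic additive group *)

Section Rigidity.
Variable A : groupType.
Hypothesis abA : abelian_group A.

Lemma hom_iterM (s : A -> A) n x y : (forall x y, s (x * y) = s x * s y) ->
  iter n s (x * y) = iter n s x * iter n s y.
Proof. by move=> sM; elim: n => //= n ->. Qed.

(** Write s = 1 + d. If s is trivial on the elements of order dividing p^k, x
    is killed by p^(k+1) and x = y^p, then d y is killed by p^2, so s fixes it
    and s^l y = (d y)^l y. Thus l kills d y and p kills d x = p d y. The
    exponent 2 cannot be lowered: inversion on the Prüfer 2-group is trivial
    on the elements of order 2. *)
Lemma prime_order_rigid (s : A -> A) p l :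
  (forall x y, s (x * y) = s x * s y) -> prime p -> prime l ->
  p_divisible A p -> (forall k x, x ^+ (p ^ k) = 1 -> iter l s x = x) ->
  (forall x, x ^+ (p ^ 2) = 1 -> s x = x) ->
  forall k x, x ^+ (p ^ k) = 1 -> s x = x.
Proof.
move=> sM p_pr l_pr divp sl s2; elim=> [|k IHk] x xk.
  by apply: s2; apply: expg_dvd xk; rewrite dvdn_exp2l.
have [lt_k2|le_2k] := ltnP k 2.
  by apply: s2; apply: expg_dvd xk; rewrite dvdn_exp2l.
have p_gt0 := prime_gt0 p_pr.
have [y yx] := divp x.
pose d z := s z * z^-1.
have dX z n : d (z ^+ n) = d z ^+ n by rewrite /d homX // ab_expgM // expVgn.
have dy2 : d y ^+ (p ^ 2) = 1.
  rewrite -dX /d IHk ?mulgV // -expgnA -expnD.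
  apply: (@expg_dvd _ _ (p * p ^ k.+1)); last by rewrite expgnA yx.
  by rewrite -expnS dvdn_exp2l // addnC addn2.
have sdy : s (d y) = d y by apply: s2.
have siter n : iter n s y = d y ^+ n * y.
  elim: n => [|n IHn]; first by rewrite mul1g.
  by rewrite iterS IHn sM homX // sdy expgSr -mulgA mulgVK.
have dyl : d y ^+ l = 1.
  apply: (mulIg y); rewrite -siter mul1g; apply: (sl k.+2).
  by rewrite expnS expgnA yx.
suff dx : d x = 1 by apply: (mulIg x^-1); rewrite -/(d x) dx mulgV.
rewrite -yx dX; have [<- //|neq_lp] := eqVneq l p.
apply: (@expg_coprime_eq1 _ _ l p); first exact: prime_gt0.
- by rewrite prime_coprime // dvdn_prime2.
- by rewrite -expgnA mulnC expgnA dyl expg1n.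
- by rewrite -expgnA mulnn.
Qed.

(** The prime factors of the order of s are removed one at a time, starting
    with the order of a power of s. *)
Lemma finite_order_rigid (s : A -> A) p m :
  (forall x y, s (x * y) = s x * s y) -> prime p -> p_divisible A p ->
  (0 < m)%N -> (forall k x, x ^+ (p ^ k) = 1 -> iter m s x = x) ->
  (forall x, x ^+ (p ^ 2) = 1 -> s x = x) ->
  forall k x, x ^+ (p ^ k) = 1 -> s x = x.
Proof.
move=> sM p_pr divp; elim/ltn_ind: m => m IHm m_gt0 sm s2 k x xk.
have [m1|m_neq1] := eqVneq m 1%N; first by have := sm k x xk; rewrite m1.
have l_pr : prime (pdiv m) by rewrite pdiv_prime // ltn_neqAle eq_sym m_neq1.
have l_m := pdiv_dvd m; set l := pdiv m in l_pr l_m.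
have q_gt0 : (0 < m %/ l)%N by rewrite divn_gt0 ?prime_gt0 // dvdn_leq.
apply: (IHm (m %/ l)%N) xk => //; first by rewrite ltn_Pdiv ?prime_gt1.
apply: (prime_order_rigid (l := l)) => //.
- by move=> y z; apply: hom_iterM.
- move=> j z zj; rewrite -[RHS](sm j) // -[in RHS](divnK l_m).
  by rewrite mulnC iterM.
- by move=> z /s2 sz; elim: (m %/ l)%N => //= n ->.
Qed.
End Rigidity.

Section LambdaAction.
Variable A : groupType.
Hypothesis abA : abelian_group A.
Hypothesis divA : divisible A.
Hypothesis perA : periodic A.
Hypothesis finA : finite_torsion A.

Variable lam : A -> A -> A.
Hypothesis lamM : forall a x y, lam a (x * y) = lam a x * lam a y.
Hypothesis lam_circ : forall a b x, lam (a * lam a b) x = lam a (lam b x).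
Hypothesis lam1 : forall x, lam 1 x = x.
Hypothesis lam_inj : forall a, injective (lam a).

Lemma lamX a x n : lam a (x ^+ n) = lam a x ^+ n.
Proof. exact: homX. Qed.

Lemma lam_torsion a x n : x ^+ n = 1 -> lam a x ^+ n = 1.
Proof. by rewrite -lamX => ->; rewrite hom1. Qed.

(** The powers of a for the operation a ∘ b = a (lam a b) stay in the finite
    group of elements of order dividing that of a, so two of them coincide and
    so do two powers of [lam a]. *)
Lemma lam_finite_order a : exists2 m, (0 < m)%N & forall x, iter m (lam a) x = x.
Proof.
have [n n_gt0 an] := perA a.
pose c i := iter i (fun b => a * lam a b) 1.
have lam_c i x : lam (c i) x = iter i (lam a) x.
  by elim: i => //= i IHi; rewrite lam_circ IHi.
have cn i : c i ^+ n = 1.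
  elim: i => [|i IHi]; rewrite ?expg1n //=.
  by rewrite ab_expgM // an mul1g lam_torsion.
have [M pig] := pigeonhole_set (finA n_gt0).
have [i [j [/andP[lt_ij _] cij]]] := pig c cn.
exists (j - i)%N; first by rewrite subn_gt0.
move=> x; have iter_inj : injective (iter i (lam a)).
  elim: (i) => // k IHk u v /= /lam_inj; exact: IHk.
by apply: iter_inj; rewrite -iterD subnKC 1?ltnW // -!lam_c cij.
Qed.

(** The inverse of d for the operation a ∘ b = a (lam a b), with its order
    controlled: the order n is the one for the given group law. *)
Lemma circ_inverse d n : d ^+ n = 1 -> exists d', [/\ d' ^+ n = 1,
  forall x, lam d (lam d' x) = x & forall e, (e * lam e d') * lam (e * lam e d') d = e].
Proof.
move=> dn; have [m m_gt0 dm] := lam_finite_order d.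
pose d' := iter m.-1 (lam d) d^-1.
have d'd : d * lam d d' = 1 by rewrite /d' -iterS prednK // dm mulgV.
have lamK x : lam d (lam d' x) = x by rewrite -lam_circ d'd lam1.
exists d'; split=> // [|e].
  by rewrite /d'; elim: m.-1 => [|i IHi]; rewrite ?expVgn ?dn ?invg1 //= lam_torsion.
rewrite lam_circ -mulgA -lamM; suff -> : d' * lam d' d = 1 by rewrite hom1 ?mulg1.
apply: (@lam_inj d); rewrite lamM lamK hom1 //.
by rewrite abA d'd.
Qed.

(** Let K be the set of q-elements acting trivially on the p-part. Among the
    powers c^0, ..., c^M two act in the same way on the finite group of
    elements of order dividing p^2, hence, by rigidity, differ by an element
    of K for the second operation. The hypothesis turns this into a difference
    for the given group law: c^n lies in K for some 0 < n <= M, so c^(M!) lies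
    in K for every q-element c, and divisibility gives the rest. *)
Lemma primary_acts_trivially p q : prime p -> prime q ->
  (forall k i d j, k ^+ (q ^ i) = 1 -> d ^+ (q ^ j) = 1 ->
     (forall l x, x ^+ (p ^ l) = 1 -> lam k x = x) -> lam k d = d) ->
  forall a i x l, a ^+ (q ^ i) = 1 -> x ^+ (p ^ l) = 1 -> lam a x = x.
Proof.
move=> p_pr q_pr trivK a i x l ai xl; have q_gt0 := prime_gt0 q_pr.
pose K k := (exists j, k ^+ (q ^ j) = 1) /\
            forall l x, x ^+ (p ^ l) = 1 -> lam k x = x.
have KM k k' : K k -> K k' -> K (k * k').
  move=> [[j kj] Kk] [[j' kj'] Kk']; split.
    exists (j + j')%N; rewrite ab_expgM //.
    by rewrite (expg_dvd _ kj) ?(expg_dvd _ kj') ?mulg1 // dvdn_exp2l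
      ?leq_addl ?leq_addr.
  move=> r z zr; have {1}<- : lam k k' = k' by apply: (trivK k j k' j').
  by rewrite lam_circ (Kk' r) // (Kk r).
have K1 : K 1 by split; [exists 0%N; rewrite expg1n | move=> *; rewrite lam1].
have KX k n : K k -> K (k ^+ n).
  by move=> Kk; elim: n => [|n IHn]; rewrite ?expg0 // expgS; apply: KM.
have F_gt0 : (0 < p ^ 2)%N by rewrite expn_gt0 prime_gt0.
have [M pig] := pigeonhole_maps (finA F_gt0).
have M_gt0 : (0 < M`!)%N := fact_gt0 M.
have [u co_qu ME] := pfactor_coprime q_pr M_gt0; set t := logn q M`! in ME.
have u_gt0 : (0 < u)%N by move: M_gt0; rewrite ME muln_gt0 => /andP[].
(* A q-power root of a, unlike an M!-th root, is again a q-element. *)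
have [c ca] : exists c, c ^+ (q ^ t) = a.
  elim: t {ME} => [|t [c ca]]; first by exists a.
  by have [b bc] := divA q_pr c; exists b; rewrite expnS expgnA bc.
have ct n : (c ^+ n) ^+ (q ^ (t + i)) = 1.
  by rewrite -expgnA mulnC expnD -mulnA expgnA ca expgnA ai expg1n.
have [r [s [/andP[lt_rs le_sM] crs]]] := pig (fun n => lam (c ^+ n))
  (fun n x => @lam_torsion _ x _).
have [d' [d't lamK circK]] := circ_inverse (ct r).
pose k := c ^+ s * lam (c ^+ s) d'.
have kt : k ^+ (q ^ (t + i)) = 1.
  by rewrite ab_expgM // ct mul1g lam_torsion.
have Kk : K k.
  split; first by exists (t + i)%N.
  have [m m_gt0 km] := lam_finite_order k.
  apply: (finite_order_rigid abA (lamM k) p_pr (divA p_pr) m_gt0) => // z zp.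
  by rewrite lam_circ -crs ?lamK // /=; apply: lam_torsion.
have cE : k * c ^+ r = c ^+ s.
  have {1}<- : lam k (c ^+ r) = c ^+ r by apply: trivK kt (ct r) Kk.2.
  exact: circK.
have {cE} Kc : K (c ^+ (s - r)).
  suff -> : c ^+ (s - r) = k by [].
  by rewrite expgnFr 1?ltnW // -cE mulgK.
have Ka : K (a ^+ u).
  rewrite -ca -expgnA mulnC -ME.
  have /dvdnP[n ->] : (s - r %| M`!)%N.
    by rewrite dvdn_fact // subn_gt0 lt_rs (leq_trans (leq_subr _ _)).
  by rewrite mulnC expgnA; apply: KX.
have [|j aj] := @expg_coprimeK A a (q ^ i) u _ u_gt0 ai; first by rewrite coprimeXl.
by rewrite -aj; apply: (KX _ j Ka).2 xl.
Qed.

(** The action of each primary part on itself has to be treated first: it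
    makes the two operations agree there, which is what the count for two
    different primes starts from. *)
Theorem lambda_action_trivial a x : lam a x = x.
Proof.
have same p k d i j : prime p -> k ^+ (p ^ i) = 1 -> d ^+ (p ^ j) = 1 -> lam k d = d.
  move=> p_pr ki dj; apply: (@primary_acts_trivially p p) ki dj => //.
  by move=> ? ? e r _ er; apply; exact: er.
refine (@primary_induction A (fun a => forall x, lam a x = x) perA _ _ a x) => {a x}
  [a b lam_a lam_b x|q i a q_pr ai].
  by rewrite -{1}(lam_a b) lam_circ lam_b.
move=> x; refine (@primary_induction A (fun x => lam a x = x) perA _ _ x) => {x}
  [x y lam_x lam_y|p j x p_pr xj].
  by rewrite lamM lam_x lam_y.
apply: (@primary_acts_trivially p q) ai xj => // k r d t kr dt _.
exact: same q_pr kr dt.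
Qed.

End LambdaAction.

(** * Products of two abelian groups *)

Section Commutators.
Variable G : groupType.
Implicit Types x y z : G.

Lemma conjg_commute x y : x ^ y = x <-> commute x y.
Proof. by split=> [/conjg_fixP/commgP|/commgP/conjg_fixP]. Qed.

Lemma commute_conj x y z : commute x y -> commute (x ^ z) (y ^ z).
Proof. by rewrite /commute -!conjMg => ->. Qed.

Lemma commMgl x y z : [~ x * y, z] = [~ x, z] ^ y * [~ y, z].
Proof. by rewrite !commgEl !conjgE invgM !mulgA !mulgK. Qed.

Lemma commgMr x y z : [~ x, y * z] = [~ x, z] * [~ x, y] ^ z.
Proof. by rewrite !commgEl !conjgE !invgM !mulgA !mulgK. Qed.

Lemma conj_commute_comm x y z : z ^ (x^-1 * y^-1) = z ^ (y^-1 * x^-1) ->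
  commute z [~ x, y].
Proof.
rewrite commgCV !invgK conjgM => /conjg_inj.
by move/conjg_commute.
Qed.

Definition center : set G := [set z | forall x, commute z x].

Lemma center1 : center 1. Proof. by move=> x; apply/commute_sym/commute1. Qed.
Lemma centerM x y : center x -> center y -> center (x * y).
Proof. by move=> Zx Zy z; apply/commute_sym/commuteM; apply/commute_sym. Qed.
Lemma centerV x : center x -> center x^-1.
Proof. by move=> Zx z; apply/commute_sym/commuteV/commute_sym. Qed.
Lemma centerJ x y : center x -> x ^ y = x.
Proof. by move=> Zx; apply/conjg_commute. Qed.

End Commutators.

Section Ito.
Variables (G K L : groupType) (g : K -> G) (d : L -> G).
Hypothesis abK : abelian_group K.
Hypothesis abL : abelian_group L.
Hypothesis gM : forall x y, g (x * y) = g x * g y.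
Hypothesis dM : forall x y, d (x * y) = d x * d y.
Hypothesis factor : forall x, exists k l, x = g k * d l.

Lemma factorV x : exists l k, x = d l * g k.
Proof.
have [k [l xE]] := factor x^-1; exists l^-1, k^-1.
by rewrite (homV dM) (homV gM) -invgM -xE invgK.
Qed.

Lemma commute_g a b : commute (g a) (g b).
Proof. by rewrite /commute -!gM abK. Qed.
Lemma commute_d a b : commute (d a) (d b).
Proof. by rewrite /commute -!dM abL. Qed.

Lemma conj_gg a b : g a ^ g b = g a. Proof. exact/conjg_commute/commute_g. Qed.
Lemma conj_dd a b : d a ^ d b = d a. Proof. exact/conjg_commute/commute_d. Qed.
Lemma comm_gg a b : [~ g a, g b] = 1. Proof. by rewrite commgEl conj_gg mulVg. Qed.
Lemma comm_dd a b : [~ d a, d b] = 1. Proof. by rewrite commgEl conj_dd mulVg. Qed.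

(** Itô's computation: conjugation by either product takes the commutator to
    the same commutator [g a3, d b2], where a3 and b2 are components of
    conjugates of the given elements. *)
Lemma ito_conj a b a1 b1 :
  [~ g a, d b] ^ (g a1 * d b1) = [~ g a, d b] ^ (d b1 * g a1).
Proof.
have [a2 [b2 ab2]] := factor (d b ^ g a1).
have [b3 [a3 ab3]] := factorV (g a ^ d b1).
transitivity [~ g a3, d b2].
  rewrite conjgM conjRg conj_gg ab2 commgMr comm_gg conj1g mulg1.
  by rewrite conjRg conj_dd ab3 commMgl comm_dd conj1g mul1g.
rewrite conjgM conjRg conj_dd ab3 commMgl comm_dd conj1g mul1g.
by rewrite conjRg conj_gg ab2 commgMr comm_gg conj1g mulg1.
Qed.

Lemma ito a b a1 b1 : commute [~ g a, d b] [~ g a1, d b1].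
Proof.
by apply: conj_commute_comm; rewrite -(homV gM) -(homV dM) ito_conj.
Qed.

Definition comm_centralizer : set G :=
  [set x | forall a b, commute [~ g a, d b] x].
(** This set contains the commutators of the two factors and, once these
    commute with each other, it is an abelian normal subgroup. Its definition
    by commutation avoids the subgroup generated by the commutators. *)
Definition comm_bicenter : set G :=
  [set v | comm_centralizer v /\ forall x, comm_centralizer x -> commute v x].

Local Notation CS := comm_centralizer.
Local Notation V := comm_bicenter.

Lemma comm_conj_g a b c : [~ g a, d b] ^ g c = [~ g (a * c), d b] * [~ g c, d b]^-1.
Proof. by rewrite gM commMgl mulgK. Qed.

Lemma comm_conj_d a b c : [~ g a, d b] ^ d c = [~ g a, d c]^-1 * [~ g a, d (b * c)].
Proof. by rewrite dM commgMr mulKg. Qed.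

(** A conjugate of a commutator by an element of either factor is a product of
    such commutators and their inverses. *)
Lemma centralizer_conj x y : CS x -> CS (x ^ y).
Proof.
have CSd z k : CS z -> CS (z ^ g k).
  move=> Cz a b; rewrite -(conjgKV (g k) [~ _, _]); apply: commute_conj.
  rewrite -(homV gM) comm_conj_g; apply/commute_sym; apply: commuteM.
    exact/commute_sym/Cz.
  exact/commuteV/commute_sym/Cz.
have CSl z l : CS z -> CS (z ^ d l).
  move=> Cz a b; rewrite -(conjgKV (d l) [~ _, _]); apply: commute_conj.
  rewrite -(homV dM) comm_conj_d; apply/commute_sym; apply: commuteM.
    exact/commuteV/commute_sym/Cz.
  exact/commute_sym/Cz.
by move=> Cx; have [k [l ->]] := factor y; rewrite conjgM; apply/CSl/CSd.
Qed.

Lemma bicenter1 : V 1.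
Proof. by split=> [a b|x _]; [apply: commute1 | apply/commute_sym/commute1]. Qed.

Lemma bicenterM x y : V x -> V y -> V (x * y).
Proof.
move=> [Cx Zx] [Cy Zy]; split=> [a b|z Cz]; first exact: commuteM.
by apply/commute_sym/commuteM; apply/commute_sym; [apply: Zx | apply: Zy].
Qed.

Lemma bicenterV x : V x -> V x^-1.
Proof.
move=> [Cx Zx]; split=> [a b|z Cz]; first exact: commuteV.
by apply/commute_sym/commuteV/commute_sym/Zx.
Qed.

Lemma bicenter_commute x y : V x -> V y -> commute x y.
Proof. by move=> [_ Zx] [Cy _]; apply: Zx. Qed.

Lemma bicenterJ x y : V x -> V (x ^ y).
Proof.
move=> [Cx Zx]; split=> [|z Cz]; first exact: centralizer_conj.
rewrite -(conjgKV y z); apply: commute_conj; apply: Zx.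
exact: centralizer_conj.
Qed.

Lemma comm_bicenter_gd a b : V [~ g a, d b].
Proof. by split=> [a1 b1|x]; [apply: ito | apply]. Qed.

(** In other words, the quotient of G by the bicenter is abelian. *)
Lemma comm_in_bicenter x y : V [~ x, y].
Proof.
have V_gl k z : V [~ g k, z].
  have [a [b ->]] := factor z; rewrite commgMr comm_gg conj1g mulg1.
  exact: comm_bicenter_gd.
have V_dl l z : V [~ d l, z].
  have [b [a ->]] := factorV z; rewrite commgMr comm_dd conj1g mulg1.
  by rewrite -invgR; apply/bicenterV/comm_bicenter_gd.
have [a [b ->]] := factor x; rewrite commMgl.
by apply: bicenterM => //; apply: bicenterJ.
Qed.

(** Conjugations act on the bicenter through the abelian quotient. *)
Lemma bicenter_conjC v x y : V v -> v ^ (x * y) = v ^ (y * x).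
Proof.
move=> Vv; rewrite [x * y]commgC conjgM; apply/conjg_commute.
by apply: bicenter_commute; [apply: bicenterJ | apply: comm_in_bicenter].
Qed.

End Ito.

(** * Exact products of two divisible periodic abelian groups *)

Section CentralCommutators.
Variables (G H : groupType) (f : H -> G).
Hypothesis fM : forall x y, f (x * y) = f x * f y.
Hypothesis divH : divisible H.

Lemma central_commXr (x y : G) n : center [~ x, y] -> [~ x, y ^+ n] = [~ x, y] ^+ n.
Proof.
move=> Zxy; elim: n => [|n IHn]; first by rewrite !expg0 commg1.
by rewrite expgS commgMr IHn centerJ // expgSr.
Qed.

Lemma central_commXl (x y : G) n : center [~ x, y] -> [~ x ^+ n, y] = [~ x, y] ^+ n.
Proof.
move=> Zxy; elim: n => [|n IHn]; first by rewrite !expg0 comm1g.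
by rewrite expgS commMgl IHn centerJ // expgS.
Qed.

(** Commutation with x is a homomorphism from the divisible group H to the
    center, and its values are killed by the order of x. *)
Lemma torsion_central_comm (x : G) : finite_order x ->
  (forall a, center [~ x, f a]) -> forall a, commute x (f a).
Proof.
move=> [n n_gt0 xn] Zx a; have [b <-] := divisible_natexp a divH n_gt0.
apply/commgP/eqP; rewrite homX // central_commXr // -central_commXl // xn.
exact: comm1g.
Qed.

(** If b is a root of a of order M!, then two of v^(b^0), ..., v^(b^M) agree
    modulo the center, so some b^n with 0 < n <= M, and therefore a, commutes
    with v modulo the center. *)
Lemma finite_orbit_central (F : set G) (v : G) : finite_set F ->
  (forall a, exists2 y, F y & center (y^-1 * v ^ f a)) ->
  forall a, center [~ v, f a].
Proof.
move=> finF orbF a; have [M pig] := pigeonhole_set finF.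
have [b ba] := divisible_natexp a divH (fact_gt0 M).
have [r rP] := @choice nat G (fun i y => F y /\ center (y^-1 * v ^ f (b ^+ i)))
   (fun i => let: ex_intro2 y Fy Zy := orbF (b ^+ i) in ex_intro _ y (conj Fy Zy)).
have [i [j [/andP[lt_ij le_jM] rij]]] := pig r (fun i => (rP i).1).
have Zij : center [~ v, f (b ^+ (j - i))].
  have := centerM (centerV (rP i).2) (rP j).2.
  have -> : b ^+ j = b ^+ (j - i) * b ^+ i by rewrite -expgnDr subnK // ltnW.
  rewrite rij invgM invgK -mulgA mulVKg fM conjgM.
  rewrite -conjVg -conjMg -commgEl => Zc.
  by rewrite -(conjgK (f (b ^+ i)) [~ _, _]) centerJ.
have /dvdnP[n Mn] : (j - i %| M`!)%N.
  by rewrite dvdn_fact // subn_gt0 lt_ij (leq_trans (leq_subr _ _)).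
rewrite -ba Mn mulnC expgnA homX // central_commXr //.
elim: n {Mn} => [|n IHn]; first by rewrite expg0; apply: center1.
by rewrite expgS; apply: centerM.
Qed.

(** The factor H modulo its central elements has finite p-torsion. *)
Lemma central_roots p : abelian_group H -> periodic H -> finite_torsion H -> prime p ->
  exists2 F : set H, finite_set F &
    forall c, center (f (c ^+ p)) -> exists2 h, F h & center (f (h^-1 * c)).
Proof.
move=> abH perH finH p_pr.
apply: (@finite_roots_mod H abH [set c | center (f c)] p) => //.
- by rewrite /= (hom1 fM); apply: center1.
- by move=> x y; rewrite /= fM; apply: centerM.
- by move=> x; rewrite /= (homV fM); apply: centerV.
Qed.

End CentralCommutators.

Section Factorization.
Variables (G K L : groupType) (g : K -> G) (d : L -> G).
Hypothesis abK : abelian_group K.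
Hypothesis abL : abelian_group L.
Hypothesis gM : forall x y, g (x * y) = g x * g y.
Hypothesis dM : forall x y, d (x * y) = d x * d y.
Hypothesis divK : divisible K.
Hypothesis divL : divisible L.
Hypothesis perK : periodic K.
Hypothesis perL : periodic L.
Hypothesis finK : finite_torsion K.
Hypothesis finL : finite_torsion L.
Variables (kp : G -> K) (lp : G -> L).
Hypothesis kplp : forall x, x = (g (kp x))^-1 * d (lp x).
Hypothesis inter : forall k l, g k = d l -> k = 1 /\ l = 1.

Lemma gd_factor x : exists k l, x = g k * d l.
Proof. by exists (kp x)^-1, (lp x); rewrite (homV gM) -kplp. Qed.

Lemma parts_uniq k l : kp ((g k)^-1 * d l) = k /\ lp ((g k)^-1 * d l) = l.
Proof.
set x := _ * _; have xE : x = (g k)^-1 * d l by [].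
rewrite {1}(kplp x) in xE.
have [|k1 l1] := @inter (k * (kp x)^-1) (l * (lp x)^-1).
  rewrite gM dM (homV gM) (homV dM).
  by apply: (mulIg (d (lp x))); rewrite mulgVK -mulgA xE mulVKg.
by split; apply/esym/divg1_eq.
Qed.

(** If k^-1 l is central, then k commutes with the second factor because it is
    l times a central element. *)
Lemma center_parts k l : center ((g k)^-1 * d l) -> center (g k) /\ center (d l).
Proof.
move=> Zx; have Zk : center (g k).
  move=> y; have [a [b ->]] := gd_factor y.
  apply: commuteM; first exact: commute_g.
  have gE : g k = d l * ((g k)^-1 * d l)^-1 by rewrite invgM invgK mulVKg.
  rewrite gE; apply/commute_sym; apply: commuteM; first exact: commute_d.
  exact/commute_sym/centerV.
split=> //; rewrite -(mulVKg (g k) (d l)).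
exact: centerM.
Qed.

Local Notation V := (comm_bicenter g d).

Let VM := @bicenterM G K L g d.
Let VV := @bicenterV G K L g d.
Let V1 := @bicenter1 G K L g d.
Let VC := @bicenter_commute G K L g d.
Let VJ x y (Vx : V x) : V (x ^ y) := bicenterJ gM dM gd_factor y Vx.
Let Vconj x y v (Vv : V v) : v ^ (x * y) = v ^ (y * x) :=
  bicenter_conjC abK abL gM dM gd_factor x y Vv.

Local Notation T := {v : G | `[< V v >]}.
Definition bic v (Vv : V v) : T := exist (fun v => `[< V v >]) v (asboolT Vv).
Lemma bicP (u : T) : V (val u). Proof. exact/asboolP/(valP u). Qed.

Definition bic_add (u w : T) : T := bic (VM (bicP u) (bicP w)).
Definition bic_opp (u : T) : T := bic (VV (bicP u)).
Definition bic_zero : T := bic V1.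
Definition bic_conj (x : G) (u : T) : T := bic (VJ x (bicP u)).
(** The ring multiplication v * w = rho(v) w - w on the bicenter, where rho(v)
    is the conjugation by the component of v in the first factor. *)
Definition bic_mul (u w : T) : T := bic_add (bic_conj (g (kp (val u))) w) (bic_opp w).

Lemma bic_addA : associative bic_add.
Proof. by move=> u v w; apply: val_inj; rewrite /= mulgA. Qed.
Lemma bic_addC : commutative bic_add.
Proof. by move=> u v; apply: val_inj; apply: VC; apply: bicP. Qed.
Lemma bic_add0 : left_id bic_zero bic_add.
Proof. by move=> u; apply: val_inj; rewrite /= mul1g. Qed.
Lemma bic_addN : left_inverse bic_zero bic_opp bic_add.
Proof. by move=> u; apply: val_inj; rewrite /= mulVg. Qed.

Definition bicenter_zmod : zmodType := HB.pack T
  (GRing.isZmodule.Build T bic_addA bic_addC bic_add0 bic_addN).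
Local Notation Vz := bicenter_zmod.

Lemma circ_val (u w : T) :
  val (circ (V := Vz) bic_mul u w) = val w ^ g (kp (val u)) * val u.
Proof.
rewrite /circ /=.
rewrite -[LHS]/(val u * val w * (val w ^ g (kp (val u)) * (val w)^-1)).
have Vw := bicP w; have Vu := bicP u; have Vwu := VJ (g (kp (val u))) Vw.
rewrite -mulgA [val w * _]VC //; last exact/VM/VV.
by rewrite mulgVK; apply: VC.
Qed.

(** The adjoint operation of the ring corresponds to the product of components
    in the two factors, whence its commutativity and its periodicity. *)
Lemma circ_parts (u w : T) : val (circ (V := Vz) bic_mul u w) =
  (g (kp (val w) * kp (val u)))^-1 * d (lp (val w) * lp (val u)).
Proof.
rewrite circ_val [in X in _ * X](kplp (val u)) conjgE !mulgA mulgK.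
by rewrite [in LHS](kplp (val w)) gM dM invgM !mulgA.
Qed.

Lemma kp_circ (u w : T) :
  kp (val (circ (V := Vz) bic_mul u w)) = kp (val u) * kp (val w).
Proof. by rewrite circ_parts (parts_uniq _ _).1 abK. Qed.

Lemma bic_mulC (u w : T) : bic_mul u w = bic_mul w u.
Proof.
have circC : circ (V := Vz) bic_mul u w = circ (V := Vz) bic_mul w u.
  by apply: val_inj; rewrite !circ_parts [_ * kp _]abK [_ * lp _]abL.
apply: (@GRing.addrI Vz (bic_add u w)).
by rewrite -[LHS]/(circ (V := Vz) bic_mul u w) circC /circ [in RHS]bic_addC.
Qed.

Lemma bic_mulDr (u v w : T) :
  bic_mul u (bic_add v w) = bic_add (bic_mul u v) (bic_mul u w).
Proof.
apply: val_inj; rewrite /= conjMg invgM.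
have Vv := VV (bicP v); have Vw := bicP w; have Vwx := VJ (g (kp (val u))) Vw.
move: (_ ^ _) (_ ^ _) Vwx => a b Vb.
rewrite (VC (VV Vw) Vv) -!mulgA; congr (_ * _).
by rewrite !mulgA (VC Vb Vv).
Qed.

Lemma bic_mul_circ (u v w : T) :
  bic_add w (bic_mul (circ (V := Vz) bic_mul u v) w) =
  bic_conj (g (kp (val u))) (bic_conj (g (kp (val v))) w).
Proof.
apply: val_inj; rewrite /= kp_circ gM Vconj ?conjgM; last exact: bicP.
rewrite VC ?mulgVK //; first exact: bicP.
by apply: VM; [apply: VJ; apply: VJ | apply: VV]; apply: bicP.
Qed.

Lemma bic_conjE (u w : T) : bic_conj (g (kp (val u))) w = bic_add w (bic_mul u w).
Proof.
apply: val_inj => /=; rewrite VC ?mulgVK //; first exact: bicP.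
by apply: VM; [apply: VJ | apply: VV]; apply: bicP.
Qed.

(** Since rho(u ∘ v) = rho(u) rho(v), expanding both sides leaves exactly
    associativity. *)
Lemma bic_mulA (u v w : T) : bic_mul u (bic_mul v w) = bic_mul (bic_mul u v) w.
Proof.
have mulDl (x y : T) : bic_mul (bic_add x y) w = bic_add (bic_mul x w) (bic_mul y w).
  exact: (@rmulDl Vz bic_mul bic_mulC bic_mulDr).
have := bic_mul_circ u v w; rewrite !bic_conjE bic_mulDr.
rewrite -[circ (V := Vz) _ u v]/(bic_add (bic_add u v) (bic_mul u v)).
rewrite (mulDl (bic_add u v)) (mulDl u).
move: (bic_mul u w) (bic_mul v w) (bic_mul u (bic_mul v w)) (bic_mul (bic_mul u v) w).
move=> a b c e abE.
apply: (@GRing.addrI Vz (bic_add w (bic_add a b))).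
rewrite -[LHS]/(bic_add _ _) -[RHS]/(bic_add _ _).
by rewrite -[RHS]bic_addA abE [bic_add a b]bic_addC !bic_addA.
Qed.

Definition bic_center : set Vz := [set u | center (val u)].

Lemma bic_valMn (u : T) n : val (GRing.natmul (u : Vz) n) = val u ^+ n.
Proof.
by elim: n => [|n IHn]; rewrite ?GRing.mulr0n // GRing.mulrS expgS -IHn.
Qed.

Lemma bic_centerM (v x : Vz) : bic_center x -> bic_center (bic_mul v x).
Proof. by move=> Zx; rewrite /bic_center /= centerJ // mulgV; apply: center1. Qed.

Lemma center_conjV (x y : G) : center (x ^ y) -> center x.
Proof. by move=> Zxy; rewrite -(conjgK y x) centerJ. Qed.

(** The left side is rho(v) y, and conjugation does not move central
    elements. *)
Lemma bic_radical (v y : Vz) : bic_center (GRing.add y (bic_mul v y)) -> bic_center y.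
Proof.
rewrite -[GRing.add y _]/(bic_add y (bic_mul v y)) -bic_conjE.
exact: center_conjV.
Qed.

Lemma bic_circn (u : T) n : val (circn (V := Vz) bic_mul u n) =
  (g (kp (val u) ^+ n))^-1 * d (lp (val u) ^+ n).
Proof.
elim: n => [|n IHn]; first by rewrite !expg0 (hom1 gM) (hom1 dM) invg1 mulg1.
by rewrite circnS circ_parts IHn (parts_uniq _ _).1 (parts_uniq _ _).2 !expgSr.
Qed.

Lemma bic_torsion (u : T) :
  exists2 m, (0 < m)%N & bic_center (circn (V := Vz) bic_mul u m).
Proof.
have [m m_gt0 km] := perK (kp (val u)); have [n n_gt0 ln] := perL (lp (val u)).
exists (m * n)%N; first by rewrite muln_gt0 m_gt0.
rewrite /bic_center /= bic_circn (expg_dvd _ km) ?dvdn_mulr //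
  (expg_dvd _ ln) ?dvdn_mull //.
by rewrite (hom1 gM) (hom1 dM) invg1 mulg1; apply: center1.
Qed.

(** Conjugations commute with rho, so they are linear over the ring; they are
    not ring morphisms in general. *)
Lemma bic_mul_conj (x : G) (u w : T) :
  bic_mul u (bic_conj x w) = bic_conj x (bic_mul u w).
Proof.
apply: val_inj; rewrite /= conjMg conjVg -!conjgM Vconj //.
exact: bicP.
Qed.

Lemma bic_square_conj (x : G) (u : T) :
  bic_mul (bic_conj x u) (bic_conj x u) = bic_conj x (bic_conj x (bic_mul u u)).
Proof. by rewrite bic_mul_conj (bic_mulC (bic_conj x u)) bic_mul_conj. Qed.

(** The elements x with p x and x^2 central. The condition x^2 = 0, unlike the
    vanishing of the adjoint p-th power, is invariant under conjugation, and
    for p x = 0 the former implies the latter. *)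
Definition square_zero_layer p : set G :=
  [set v | exists2 u : T, val u = v & center (v ^+ p) /\ bic_center (bic_mul u u)].

Lemma square_zero_layerJ p x v : square_zero_layer p v -> square_zero_layer p (v ^ x).
Proof.
move=> [u <- [up uu]]; exists (bic_conj x u) => //; split.
  by rewrite -conjXg centerJ.
rewrite bic_square_conj; change (center ((val (bic_mul u u) ^ x) ^ x)).
by rewrite !(centerJ _ uu).
Qed.

(** If x = k^-1 l is in the layer, its adjoint p-th power k^(-p) l^p is
    central, so k^p and l^p are, and k and l have finitely many values modulo
    the center. *)
Lemma square_zero_layer_finite p : prime p -> exists2 F : set G, finite_set F &
  forall v, square_zero_layer p v -> exists2 f, F f & center (f^-1 * v).
Proof.
move=> p_pr.
have [FK finFK FKP] := central_roots gM abK perK finK p_pr.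
have [FL finFL FLP] := central_roots dM abL perL finL p_pr.
exists [set (g k)^-1 * d l | k in FK & l in FL]; first exact: finite_image2.
move=> _ [u <- [up uu]].
have : bic_center (circn (V := Vz) bic_mul u p).
  apply: (@square_zero_circn Vz bic_mul bic_mulDr bic_center) => //.
  - exact: center1.
  - by move=> x y; apply: centerM.
  - exact: bic_centerM.
  - by rewrite /bic_center /= bic_valMn.
rewrite /bic_center /= bic_circn => /center_parts[/FKP[k FKk kP] /FLP[l FLl lP]].
exists ((g k)^-1 * d l); first by exists k => //; exists l.
rewrite [val u]kplp -(mulVKg k (kp (val u))) -(mulVKg l (lp (val u))).
rewrite /= in kP lP.
rewrite gM dM !invgM invgK; move: kP lP.
move: (g (_ * _)) (d (_ * _)) => a b Za Zb.
have -> : (d l)^-1 * g k * (a^-1 * (g k)^-1 * (d l * b)) = a^-1 * b.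
  rewrite (centerV Za) !mulgA mulgK.
  by rewrite -[_^-1 * _^-1](centerV Za) mulgVK.
by apply: centerM => //; apply: centerV.
Qed.

(** The factors centralize the finite layer modulo the center. For u = k^-1 l
    in it, k and l then commute modulo the center with both factors, and their
    finite order upgrades this to commutation. *)
Lemma no_square_zero p (u : T) : prime p -> bic_center (GRing.natmul (u : Vz) p) ->
  bic_center (bic_mul u u) -> bic_center u.
Proof.
move=> p_pr up uu; have [F finF FP] := square_zero_layer_finite p_pr.
have Iu : square_zero_layer p (val u).
  by exists u => //; split=> //; rewrite -bic_valMn.
have Zg a : center [~ val u, g a].
  by apply: (finite_orbit_central gM divK finF) => b; apply/FP/square_zero_layerJ.
have Zd a : center [~ val u, d a].
  by apply: (finite_orbit_central dM divL finF) => b; apply/FP/square_zero_layerJ.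
have [m m_gt0 km] := perK (kp (val u)); have [n n_gt0 ln] := perL (lp (val u)).
have dE : d (lp (val u)) = g (kp (val u)) * val u.
  by rewrite [X in _ * X]kplp mulVKg.
have gE : g (kp (val u)) = d (lp (val u)) * (val u)^-1.
  by rewrite dE mulgK.
have dl_central : center (d (lp (val u))).
  move=> y; have [a [b ->]] := gd_factor y; apply: commuteM; last exact: commute_d.
  apply: (torsion_central_comm gM divK) => [|c].
    by exists n; rewrite // -(homX dM) ln hom1.
  by rewrite dE commMgl comm_gg // conj1g mul1g.
have gk_central : center (g (kp (val u))).
  move=> y; have [a [b ->]] := gd_factor y; apply: commuteM; first exact: commute_g.
  apply: (torsion_central_comm dM divL) => [|c].
    by exists m; rewrite // -(homX gM) km hom1.
  rewrite gE commMgl comm_dd // conj1g mul1g.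
  apply: (@center_conjV _ (val u)).
  have -> : [~ (val u)^-1, d c] ^ val u = [~ val u, d c]^-1.
    by rewrite invgR !commgEl !conjgE invgK !mulgA mulVg mul1g.
  exact: centerV.
rewrite /bic_center /= [val u]kplp.
by apply: centerM => //; apply: centerV.
Qed.

(** The central elements form an ideal of the radical ring that satisfies the
    hypotheses of [radical_ring_ideal_full]. *)
Theorem bicenter_central v : V v -> center v.
Proof.
move=> Vv.
apply: (@radical_ring_ideal_full Vz bic_mul bic_mulC bic_mulA bic_mulDr bic_center
  _ _ _ bic_centerM bic_radical no_square_zero bic_torsion (bic Vv)).
- exact: center1.
- by move=> x y; apply: centerM.
- by move=> x; apply: centerV.
Qed.

(** The commutators of the factors lie in the bicenter, so they are
    central. *)
Theorem factors_commute k l : commute (g k) (d l).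
Proof.
apply: (torsion_central_comm dM divL) => [|a].
  by have [m m_gt0 km] := perK k; exists m; rewrite // -(homX gM) km hom1.
apply: bicenter_central; exact: (comm_bicenter_gd abK abL gM dM gd_factor).
Qed.

End Factorization.

(** * Skew braces *)

Section Lambda.
Variable B : skewBraceType.
Local Notation A := (add_group B).
Local Notation C := (circ_group B).
Implicit Types a b c x y : A.

Definition lambda (a b : A) : A := a^-1 * brace_circ a b.

Lemma lambdaE a b : a * lambda a b = brace_circ a b.
Proof. by rewrite /lambda mulVKg. Qed.

Lemma brace_circM a b c :
  brace_circ a (b * c : A) = (brace_circ a b : A) * a^-1 * brace_circ a c.
Proof. exact: brace_circD. Qed.

Lemma brace_circ0 a : brace_circ a (1 : A) = a.
Proof.
apply: (mulIg (a^-1 * brace_circ a (1 : A))); rewrite mulgA mulVKg.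
by rewrite -brace_circM mulg1.
Qed.

(** This is the relation a ∘ 0 = a, taken at the neutral element of ∘. *)
Lemma brace_oneE : (1 : C) = (1 : A) :> B.
Proof. by rewrite -[LHS](brace_circ0 (1 : C)); apply: (@mul1g C). Qed.

Lemma lambdaM a b c : lambda a (b * c) = lambda a b * lambda a c.
Proof. by rewrite /lambda brace_circM !mulgA. Qed.

Lemma lambda1r a : lambda a 1 = 1.
Proof. exact: hom1 (lambdaM a). Qed.

Lemma lambda_circ a b x : lambda (brace_circ a b) x = lambda a (lambda b x).
Proof.
apply: (mulgI (brace_circ a b : A)).
rewrite lambdaE -[X in _ = X * _]lambdaE -mulgA -lambdaM.
by rewrite !lambdaE brace_circA.
Qed.

Lemma lambda1 x : lambda 1 x = x.
Proof. by rewrite /lambda invg1 mul1g -brace_oneE; apply: (@mul1g C). Qed.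

Lemma lambda_inj a : injective (lambda a).
Proof. by move=> x y /mulgI /(mulgI (a : C)). Qed.

Lemma trivial_lambda : (forall a x, lambda a x = x) -> trivial_brace B.
Proof. by move=> lamE a b; rewrite -[RHS](lambdaE a b) lamE. Qed.

(** The semidirect product of (B,+) by (B,∘), where c acts through lambda
    c. *)
Definition lambda_semidirect (D : Type) : Type := (D * D)%type.
Local Notation H := (lambda_semidirect B).
HB.instance Definition _ := Choice.copy H (B * B)%type.

Definition sdp_mul (u v : H) : H :=
  ((u.1 : A) * lambda u.2 v.1, (u.2 : C) * v.2).
Definition sdp_one : H := ((1 : A), (1 : C)).
Definition sdp_inv (u : H) : H := (lambda ((u.2 : C)^-1) ((u.1 : A)^-1), (u.2 : C)^-1).

Lemma sdp_mulA : associative sdp_mul.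
Proof.
move=> u v w; congr pair => /=; last exact: (@mulgA C).
by rewrite lambdaM mulgA [in RHS]lambda_circ.
Qed.

Lemma sdp_mul1g : left_id sdp_one sdp_mul.
Proof. by case=> a c; congr pair => /=; rewrite mul1g // brace_oneE lambda1. Qed.

Lemma sdp_mulg1 : right_id sdp_one sdp_mul.
Proof. by case=> a c; rewrite /sdp_mul /= lambda1r !mulg1. Qed.

Lemma sdp_mulVg : left_inverse sdp_one sdp_inv sdp_mul.
Proof. by case=> a c; rewrite /sdp_mul /= -lambdaM !mulVg lambda1r. Qed.

Lemma sdp_mulgV : right_inverse sdp_one sdp_inv sdp_mul.
Proof.
case=> a c; congr pair => /=; last exact: (@mulgV C).
rewrite -lambda_circ; have -> : brace_circ c (c : C)^-1 = (1 : A).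
  by rewrite -brace_oneE; apply: (@mulgV C).
by rewrite lambda1 mulgV.
Qed.

HB.instance Definition _ := isGroup.Build H sdp_mulA sdp_mul1g sdp_mulg1
  sdp_mulVg sdp_mulgV.

Definition sdp_diag (c : C) : H := (c, c).
Definition sdp_circ (c : C) : H := ((1 : A), c).

Lemma sdp_diagM (x y : C) : sdp_diag (x * y : C) = sdp_diag x * sdp_diag y.
Proof. by congr pair => //=; rewrite lambdaE. Qed.

Lemma sdp_circM (x y : C) : sdp_circ (x * y : C) = sdp_circ x * sdp_circ y.
Proof. by congr pair => //=; rewrite lambda1r mulg1. Qed.

(** The factorization of (b,c) is (b',b')^-1 (0, b' ∘ c), where b' is the
    inverse of b for ∘. *)
Lemma sdp_factor (u : H) : u =
  (sdp_diag ((u.1 : C)^-1))^-1 * sdp_circ ((u.1 : C)^-1 * u.2).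
Proof.
apply: (mulgI (sdp_diag ((u.1 : C)^-1))); rewrite mulVKg.
congr pair => //=; rewrite lambdaE.
by rewrite -[brace_circ _ _]/((u.1 : C)^-1 * u.1) mulVg -brace_oneE.
Qed.

Lemma sdp_exact k l : sdp_diag k = sdp_circ l -> k = 1 /\ l = 1.
Proof. by case=> -> <-; rewrite -brace_oneE. Qed.

Lemma commute_lambda k l : commute (sdp_diag k) (sdp_circ l) -> lambda l k = k.
Proof. by case; rewrite lambda1r mulg1 mul1g. Qed.

End Lambda.

Theorem theorem4p13 (B : skewBraceType)
    (hB : [/\ abelian_group (add_group B), divisible (add_group B),
              periodic (add_group B) &
              finite_abelian_subgroup_rank (add_group B)]
       \/ [/\ abelian_group (circ_group B), divisible (circ_group B),
              periodic (circ_group B) &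
              finite_abelian_subgroup_rank (circ_group B)]) :
  trivial_brace B.
Proof.
apply: trivial_lambda => a x; case: hB => -[ab div per [_ rank]].
  have fin := finite_rank_torsion ab rank.
  apply: (lambda_action_trivial ab div per fin) => //.
  - exact: lambdaM.
  - by move=> b c y; rewrite lambdaE lambda_circ.
  - exact: lambda1.
  - exact: lambda_inj.
have fin := finite_rank_torsion ab rank.
apply: commute_lambda.
exact: (factors_commute ab ab (@sdp_diagM B) (@sdp_circM B) div div per per
  fin fin (@sdp_factor B) (@sdp_exact B)).
Qed.
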